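(* If $D$ is an $n$-vertex digraph, then the multiplicity of $-1$ as a root of $A_D(t)$ is at most $n-s_2(n)$, where $s_2(n)$ is the number of $1$'s in the binary expansion of $n$. Moreover, for every positive integer $n$ there exists an $n$-vertex digraph $D$ with \[A_D(t)=\frac{n!}{2^{\,n-s_2(n)}}(1+t)^{n-s_2(n)}.\]
   Context: A digraph $D=(V,E)$ has finite vertex set $V$ and arc set $E\subseteq V\times V$ with no loops (no multiple arcs). For an $n$-vertex digraph $D$, a descent of a bijection $\sigma:V\to[n]$ is an arc $u\to v$ with $\sigma(u)>\sigma(v)$, $\mathrm{des}_D(\sigma)$ is the number of descents, and $A_D(t)=\sum_{\sigma}t^{\mathrm{des}_D(\sigma)}$ summed over all bijections $\sigma:V\to[n]$. *)

(* Defs.v *)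
From mathcomp Require Import all_boot all_order all_algebra.

Set Implicit Arguments.
Unset Strict Implicit.
Unset Printing Implicit Defensive.

Import GRing.Theory.
Local Open Scope ring_scope.

Record digraph (V : finType) := Digraph {
  arc :> rel V;
  arc_irreflexive : irreflexive arc
}.

Definition bijectiveb (A B : finType) (f : A -> B) : bool :=
  injectiveb f && [forall y, y \in codom f].

(* Labels are 'I_#|V| = {0, ..., n-1} rather than {1, ..., n}; only their order
   matters for descents. *)
Definition descents (V : finType) (D : digraph V)
    (s : {ffun V -> 'I_#|V|}) : {set V * V} :=
  [set a : V * V | D a.1 a.2 && (s a.2 < s a.1)%N].

Definition des (V : finType) (D : digraph V) (s : {ffun V -> 'I_#|V|}) : nat :=
  #|descents D s|.

(* A_D(t), with rational coefficients so that n! / 2^k can be written directly. *)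
Definition eulerian_poly (V : finType) (D : digraph V) : {poly rat} :=
  \sum_(s : {ffun V -> 'I_#|V|} | bijectiveb s) 'X^(des D s).

(* The binary digit of n at position i is odd (n %/ 2 ^ i); it vanishes for
   i >= n because n < 2 ^ n. *)
Definition s2 (n : nat) : nat := (\sum_(i < n) odd (n %/ 2 ^ i))%N.

(* Main.v *)
Require Import Defs.
From mathcomp Require Import all_boot all_order all_algebra.
Import GRing.Theory Num.Theory.
Local Open Scope ring_scope.

(** By Legendre's formula [n - s2 n] is the 2-adic valuation of [n!].

    Upper bound: [A_D] has integer coefficients and [1 + t] is monic, so if
    [(1 + t)^m] divides [A_D] it does so over the integers; evaluating at
    [t = 1] gives [2^m | n!].

    Sharpness: if a digraph has an automorphism exchanging [u] and [v], then
    relabelling along it shows that adding the arc [u -> v] multiplies [A] by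
    [(1 + t) / 2].  Starting from the empty digraph, whose polynomial is [n!],
    one can add [n - s2 n] arcs in this way: pair up the vertices, join the two
    vertices of each pair, and recurse on the [n %/ 2] tails of these arcs,
    the automorphisms being extended to act on whole pairs. *)

(** * Arithmetic preliminaries: binary digits, Legendre's formula, divisibility over the integers *)

Lemma s2_widen (n m : nat) : (n <= m)%N ->
  s2 n = (\sum_(i < m) odd (n %/ 2 ^ i))%N.
Proof.
move=> le_nm; rewrite /s2.
rewrite -!(big_mkord predT (fun i => nat_of_bool (odd (n %/ 2 ^ i)))).
rewrite (big_cat_nat (leq0n n) le_nm) /= [X in (_ + X)%N]big_nat.
rewrite [X in (_ + X)%N]big1 ?addn0 // => i.
case/andP=> le_ni _; rewrite divn_small //.
exact: leq_trans (ltn_expl n (ltnSn 1)) (leq_pexp2l _ le_ni).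
Qed.

Lemma s2_half (n : nat) : s2 n = (odd n + s2 n./2)%N.
Proof.
rewrite (@s2_widen n n.+1) // big_ord_recl expn0 divn1; congr addn.
rewrite (@s2_widen n./2 n); last by rewrite leq_half_double leqW // -addnn leq_addr.
by apply: eq_bigr => i _; rewrite /bump /= expnS divnMA divn2.
Qed.

Lemma s2_leq (n : nat) : (s2 n <= n)%N.
Proof.
rewrite /s2 -[leqRHS]card_ord -sum1_card.
by apply: leq_sum => i _; case: odd.
Qed.

(** This is the arc count of the doubling construction: one arc per pair, plus the arcs from the
    recursion on [n./2] vertices. *)
Lemma subn_s2_half (n : nat) : (n - s2 n = n./2 + (n./2 - s2 n./2))%N.
Proof.
rewrite s2_half -{1}[n]odd_double_half subnDl -addnn addnBA //.
exact: s2_leq.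
Qed.

(** With [S] the Legendre sum, [\sum_(i < n) n %/ 2 ^ i] is computed twice: splitting off the last
    bit of each quotient gives [s2 n + 2 * S], while shifting the index gives [n + S], since
    [n %/ 2 ^ n] is 0. *)
Lemma logn2_fact (n : nat) : logn 2 n`! = (n - s2 n)%N.
Proof.
rewrite logn_fact // big_add1 /= big_mkord; set S := (X in X = _).
have digits : (\sum_(i < n) n %/ 2 ^ i = s2 n + S.*2)%N.
  rewrite /S -mul2n big_distrr -big_split; apply: eq_bigr => i _ /=.
  by rewrite expnSr divnMA divn2 mul2n odd_double_half.
have shift : (\sum_(i < n) n %/ 2 ^ i = n + S)%N.
  have := @big_ord_recr _ _ addn n (fun i => n %/ 2 ^ i)%N.
  rewrite big_ord_recl divn1 /= (divn_small (ltn_expl n (ltnSn 1))) addn0.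
  by move=> <-.
have /addIn def_n : (s2 n + S + S = n + S)%N.
  by rewrite -addnA addnn -digits shift.
exact: canRL (addKn _) def_n.
Qed.

(** Linear factors are peeled off one at a time: [a] is already a root over the integers, where the
    factor theorem applies, and the common factor is cancelled over the rationals. *)
Lemma XsubC_expr_dvdp_int (a : int) (m : nat) (p : {poly int}) :
  ('X - (a%:~R)%:P) ^+ m %| (map_poly intr p : {poly rat}) ->
  exists q, p = q * ('X - a%:P) ^+ m.
Proof.
elim: m p => [|m IHm] p; first by exists p; rewrite expr0 mulr1.
rewrite exprS => dvd_p.
have root_p : root (map_poly intr p : {poly rat}) (a%:~R).
  by rewrite -dvdp_XsubCl; apply: dvdp_trans dvd_p; rewrite dvdp_mulIl.
have /factor_theorem[q def_p] : root p a.
  by move: root_p; rewrite !rootE horner_map /= intr_eq0.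
move: dvd_p; rewrite def_p rmorphM /= map_polyXsubC mulrC.
rewrite dvdp_mul2r ?polyXsubC_eq0 // => /IHm[r ->].
by exists r; rewrite -mulrA -exprSr.
Qed.

(** * Labellings and the upper bound *)

Section Labellings.

Variable V : finType.

Lemma bijectiveb_card (s : {ffun V -> 'I_#|V|}) : bijectiveb s = injectiveb s.
Proof.
rewrite /bijectiveb andb_idr // => /injectiveP inj_s.
by apply/forallP=> y; apply: inj_card_onto; rewrite ?card_ord.
Qed.

Lemma card_bijectiveb : #|[pred s : {ffun V -> 'I_#|V|} | bijectiveb s]| = #|V|`!.
Proof.
have := card_inj_ffuns V 'I_#|V|; rewrite card_ord ffactnn => <-.
by rewrite cardsE; apply: eq_card => s; rewrite !inE bijectiveb_card.
Qed.

Lemma eulerian_poly_int (D : digraph V) : eulerian_poly D =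
  map_poly intr (\sum_(s : {ffun V -> 'I_#|V|} | bijectiveb s) 'X^(des D s)).
Proof. by rewrite rmorph_sum; apply: eq_bigr => s _; rewrite /= map_polyXn. Qed.

Lemma mup_eulerian_poly (D : digraph V) :
  (mup (-1) (eulerian_poly D) <= #|V| - s2 #|V|)%N.
Proof.
rewrite eulerian_poly_int; set p := \sum_(s | _) _.
have p1 : p.[1] = #|V|`!%:R.
  rewrite horner_sum -card_bijectiveb -sumr_const.
  by apply: eq_bigr => s _; rewrite hornerXn expr1n.
have p_neq0 : map_poly intr p != 0 :> {poly rat}.
  have p_neq0 : p != 0.
    apply: contra_eq_neq p1 => ->.
    by rewrite horner0 eq_sym pnatr_eq0 -lt0n fact_gt0.
  by rewrite map_poly_eq0_id0 // intr_eq0 lead_coef_eq0.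
have := leqnn (mup (-1) (map_poly intr p : {poly rat})).
rewrite {1}mup_geq //; set m := mup _ _.
have -> : -1 = (-1)%:~R :> rat by [].
case/XsubC_expr_dvdp_int=> q def_p.
rewrite -logn2_fact -pfactor_dvdn ?fact_gt0 //.
move: p1; rewrite def_p hornerM horner_exp hornerXsubC opprK => p1.
have : (2 ^+ m %| #|V|`!%:R)%Z by rewrite -p1 dvdz_mull.
by rewrite -natrX !natz.
Qed.

(** * Lists of arcs and automorphisms exchanging two vertices *)

Definition arc_descents (l : seq (V * V)) (s : {ffun V -> 'I_#|V|}) : nat :=
  count (fun a => s a.2 < s a.1)%N l.

Definition arcs_poly (l : seq (V * V)) : {poly rat} :=
  \sum_(s : {ffun V -> 'I_#|V|} | bijectiveb s) 'X^(arc_descents l s).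

Definition map_arc (W : finType) (f : V -> W) (a : V * V) : W * W :=
  (f a.1, f a.2).

Lemma arcs_poly_cons (u v : V) (l : seq (V * V)) (f : V -> V) :
    u != v -> injective f -> f u = v -> f v = u ->
    perm_eq (map (map_arc V f) l) l ->
  arcs_poly ((u, v) :: l) = 2^-1 *: ((1 + 'X) * arcs_poly l).
Proof.
move=> neq_uv inj_f fu fv aut_f.
have [g fK gK] := injF_bij inj_f.
pose rho (h : V -> V) (s : {ffun V -> 'I_#|V|}) := [ffun x => s (h x)].
have rho_bij : bijective (rho f).
  by exists (rho g) => s; apply/ffunP=> x; rewrite !ffunE ?fK ?gK.
have rho_bijb s : bijectiveb (rho f s) = bijectiveb s.
  rewrite !bijectiveb_card; apply/injectiveP/injectiveP => inj_s x y.
    rewrite -[x]gK -[y]gK => eq_s.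
    by congr f; apply: inj_s; rewrite !ffunE.
  by rewrite !ffunE => /inj_s/inj_f.
have rho_desc s : arc_descents l (rho f s) = arc_descents l s.
  rewrite /arc_descents -[RHS](permP aut_f) count_map.
  by apply: eq_count => a; rewrite /= !ffunE.
(* Composing labellings with [f] keeps the number of descents on [l] and turns a descent along
   [(u, v)] into one along [(v, u)]. *)
have swapped : arcs_poly ((u, v) :: l) = arcs_poly ((v, u) :: l).
  rewrite /arcs_poly [RHS](reindex (rho f)) /=; last exact: onW_bij.
  apply: eq_big => [s|s _]; first by rewrite rho_bijb.
  by rewrite /arc_descents /= !ffunE fu fv -!/(arc_descents l _) rho_desc.
(* Each labelling has a descent along exactly one of the two opposite arcs. *)
have sum_uv : arcs_poly ((u, v) :: l) + arcs_poly ((v, u) :: l)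
    = (1 + 'X) * arcs_poly l.
  rewrite -big_split mulr_sumr; apply: eq_bigr => s.
  rewrite bijectiveb_card => /injectiveP inj_s.
  rewrite /arc_descents /= -!/(arc_descents l s) !exprD -mulrDl.
  congr (_ * _).
  case: ltngtP => [_|_|/val_inj/inj_s eq_uv]; rewrite ?expr0 ?expr1 //.
    by rewrite addrC.
  by rewrite eq_uv eqxx in neq_uv.
by rewrite -sum_uv -swapped -mulr2n -scaler_nat scalerA mulVf ?scale1r.
Qed.

(** The head is the arc added last, so [f] has to preserve only the arcs behind it. Excluding
    repetitions lets the list stand for the arc set of a digraph. *)
Fixpoint swap_built (l : seq (V * V)) : Prop :=
  if l is a :: l' then
    [/\ a.1 != a.2, a \notin l',
        exists f : V -> V, [/\ injective f, f a.1 = a.2, f a.2 = a.1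
                             & perm_eq (map (map_arc V f) l') l']
      & swap_built l']
  else True.

Lemma arcs_poly_swap_built (l : seq (V * V)) : swap_built l ->
  arcs_poly l = (#|V|`!%:R / 2 ^+ size l) *: (1 + 'X) ^+ size l.
Proof.
elim: l => [_|[u v] l IHl [/= neq_uv _ [f [inj_f fu fv aut_f]] /IHl arcs_l]].
  rewrite /arcs_poly /= expr0 divr1.
  by rewrite sumr_const card_bijectiveb scaler_nat.
rewrite (arcs_poly_cons u v l f) // arcs_l -scalerAr scalerA -exprS.
by congr (_ *: _); rewrite exprS invfM mulrCA.
Qed.

Lemma swap_built_uniq (l : seq (V * V)) : swap_built l -> uniq l.
Proof. by elim: l => //= a l IHl [_ -> _ /IHl]. Qed.

Lemma swap_built_irreflexive (l : seq (V * V)) :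
  swap_built l -> irreflexive (fun x y => (x, y) \in l).
Proof.
move=> built_l x; elim: l built_l => //= a l IHl [neq_a _ _ /IHl l_x].
by rewrite inE l_x orbF; apply: contraNF neq_a => /eqP<-.
Qed.

Lemma eulerian_poly_swap_built (l : seq (V * V)) : swap_built l ->
  exists D : digraph V,
    eulerian_poly D = (#|V|`!%:R / 2 ^+ size l) *: (1 + 'X) ^+ size l.
Proof.
move=> built_l; exists (Digraph (swap_built_irreflexive l built_l)).
rewrite -arcs_poly_swap_built //; apply: eq_bigr => s _; congr ('X^_).
rewrite /arc_descents -size_filter -(card_uniqP _); last first.
  by rewrite filter_uniq ?swap_built_uniq.
by rewrite /des cardsE; apply: eq_card => -[x y]; rewrite mem_filter andbC.
Qed.

End Labellings.

(** * The doubling construction *)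

Section Doubling.

Variables V U : finType.

Let W : finType := (V * bool + U)%type.

Definition double_head (x : V) : W := inl (x, false).

Definition pair_arc (x : V) : W * W := (inl (x, false), inl (x, true)).

Lemma pair_arc_inj : injective pair_arc.
Proof. by move=> x y []. Qed.

(** The pair arcs stand at the end of the list, hence are added first: [flip_pair] need not preserve
    the copies of the arcs of [l]. *)
Definition double_arcs (l : seq (V * V)) : seq (W * W) :=
  map (map_arc V W double_head) l ++ map pair_arc (enum V).

Lemma size_double_arcs (l : seq (V * V)) :
  size (double_arcs l) = (size l + #|V|)%N.
Proof. by rewrite size_cat 2!size_map -cardE. Qed.

Definition flip_pair (x : V) (w : W) : W :=
  match w with
  | inl (y, b) => inl (y, (y == x) (+) b)
  | inr z => inr z
  end.

Lemma flip_pairK (x : V) : involutive (flip_pair x).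
Proof. by case=> [[y b]|z] //=; rewrite addKb. Qed.

Definition double_map (f : V -> V) (w : W) : W :=
  match w with
  | inl (y, b) => inl (f y, b)
  | inr z => inr z
  end.

Lemma double_map_inj (f : V -> V) : injective f -> injective (double_map f).
Proof. by move=> inj_f [[y b]|z] [[y' b']|z'] //= [/inj_f-> ->]. Qed.

(** Flipping one pair fixes every other pair arc. *)
Lemma swap_built_pair_arcs (r : seq V) : uniq r -> swap_built W (map pair_arc r).
Proof.
elim: r => //= x r IHr /andP[xr /IHr built_r]; split=> //.
- by apply/eqP; case.
- by rewrite (mem_map pair_arc_inj).
exists (flip_pair x); split; rewrite /= ?eqxx //.
  exact: inv_inj (flip_pairK x).
rewrite -map_comp.
suff /eq_in_map-> : {in r, map_arc W W (flip_pair x) \o pair_arc =1 pair_arc} by [].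
by move=> y yr; rewrite /map_arc /= (negPf (memPn xr y yr)).
Qed.

(** The pair arcs do not obstruct adding the copies of [l]: [double_map f] moves whole pairs, so it
    permutes the pair arcs as [f] permutes [V]. *)
Lemma swap_built_double (l : seq (V * V)) :
  swap_built V l -> swap_built W (double_arcs l).
Proof.
rewrite /double_arcs.
elim: l => [_|[u v] l IHl [/= neq_uv uvl [f [inj_f fu fv aut_f]] /IHl built_l]].
  exact: swap_built_pair_arcs (enum_uniq V).
split=> //=.
- by apply: contra neq_uv => /eqP[->].
- rewrite mem_cat negb_or; apply/andP; split.
    by rewrite mem_map // => -[x y] [x' y'] [-> ->].
  by apply/mapP=> -[x _].
exists (double_map f); split; rewrite /= ?fu ?fv //.
  exact: double_map_inj.
rewrite map_cat perm_cat //.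
  rewrite -map_comp (eq_map (g := map_arc V W double_head \o map_arc V V f)) //.
  by rewrite map_comp perm_map.
rewrite -map_comp (eq_map (g := pair_arc \o f)) // map_comp perm_map //.
apply: uniq_perm => [||x]; last 1 first.
- by have [g _ gK] := injF_bij inj_f; rewrite mem_enum -[x]gK map_f // mem_enum.
- by rewrite (map_inj_uniq inj_f) enum_uniq.
- exact: enum_uniq.
Qed.

End Doubling.

Lemma swap_built_exists (n : nat) :
  exists (V : finType) (l : seq (V * V)),
    [/\ #|V| = n, swap_built V l & size l = (n - s2 n)%N].
Proof.
elim/ltn_ind: n => -[_|n IHn].
  by exists 'I_0, [::]; rewrite card_ord.
have [|V [l [cardV built_l size_l]]] := IHn n.+1./2.
  by rewrite ltn_half_double -addnn addSn ltnS leq_addl.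
(* The second summand is the isolated vertex left over when [n.+1] is odd, and is empty
   otherwise. *)
exists (V * bool + 'I_(odd n.+1))%type, (double_arcs V _ l); split.
- by rewrite card_sum card_prod card_bool card_ord cardV muln2 addnC odd_double_half.
- exact: swap_built_double.
- by rewrite size_double_arcs size_l cardV (subn_s2_half n.+1) addnC.
Qed.

Theorem theorem1p7 :
  (forall (n : nat) (V : finType) (D : digraph V), #|V| = n ->
     (mup (-1) (eulerian_poly D) <= n - s2 n)%N)
  /\
  (forall n : nat, (0 < n)%N ->
     exists (V : finType) (D : digraph V),
       #|V| = n /\
       eulerian_poly D =
         (n`!%:R / 2 ^+ (n - s2 n)) *: (1 + 'X) ^+ (n - s2 n)).
Proof.
split=> [n V D <-|n _]; first exact: mup_eulerian_poly.
have [V [l [cardV /eulerian_poly_swap_built[D AD] size_l]]] := swap_built_exists n.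
by exists V, D; rewrite AD size_l cardV.
Qed.
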